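(* Let $\mathbb{K}$ be a field, let $m, n, d\in \mathbb{N}$ with $0\le d < \min\{m,n\}$, and let $\alpha,\beta\in \mathbb{K}$. Then, in $\mathbb{K}[x]$, $$\operatorname{Sres}_d\big((x-\alpha)^m,(x-\beta)^n\big)=(-1)^{\binom{d}{2}}(\alpha-\beta)^{(m-d)(n-d)} \sum_{j=0}^d q_j(m,n,d)\,(x-\alpha)^j(x-\beta)^{d-j}.$$
   Context: Here $0\in\mathbb{N}$. Subresultants. Let $f=f_mx^m+\cdots+f_0$ and $g=g_nx^n+\cdots+g_0$ be polynomials in $\mathbb{K}[x]$ with $f_m\ne 0$, $g_n\neq 0$, and let $0\le d<\min\{m,n\}$. Set $f_\ell=0$ for $\ell<0$ or $\ell>m$, and $g_\ell=0$ for $\ell<0$ or $\ell>n$. The order-$d$ subresultant $\operatorname{Sres}_d(f,g)\in\mathbb{K}[x]$ is the determinant of the following $(m+n-2d)\times(m+n-2d)$ matrix. For $1\le i\le n-d$, row $i$ has entry $f_{m+i-k}$ in column $k$ for $1\le k\le m+n-2d-1$, and entry $x^{n-d-i}f$ in the last column. For $1\le i\le m-d$, row $(n-d)+i$ has entry $g_{n+i-k}$ in column $k$ for $1\le k\le m+n-2d-1$, and entry $x^{m-d-i}g$ in the last column. The integers $q_j(m,n,d)$. Set $c:=m+n-2d-1$. For $0<d<\min\{m,n\}$ let $H(m,n,d)$ be the $d\times(d+1)$ integer matrix $\left(\binom{c}{m-i-j}\right)_{1\le i\le d,\ 0\le j\le d}$, with rows indexed by $i$ and columns by $j$, where $\binom{c}{k}=0$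 for $k<0$ and for $k>c$. For $0\le j\le d$, $q_j(m,n,d)\in\mathbb{Z}$ is the determinant of the $d\times d$ submatrix of $H(m,n,d)$ obtained by deleting its $(j+1)$-th column (that is, the column indexed by $j$). By convention $q_0(m,n,0)=1$. The integers $q_j(m,n,d)$ are regarded as elements of $\mathbb{K}$ via the natural ring homomorphism $\mathbb{Z}\to\mathbb{K}$. *)

(* Defs.v *)
From mathcomp Require Import all_boot all_order all_algebra.

Set Implicit Arguments.
Unset Strict Implicit.
Unset Printing Implicit Defensive.

Import GRing.Theory.
Local Open Scope ring_scope.

(* Coefficient of index k, for a possibly negative k: ssrnat subtraction
   truncates, so the differences of indices below are computed in int. *)
Definition coefz (K : fieldType) (p : {poly K}) (k : int) : K :=
  if k is Posz l then p`_l else 0.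

Definition binz (c : nat) (k : int) : int :=
  if k is Posz l then 'C(c, l)%:Z else 0.

(* Rows and columns are numbered from 0: (i, k) here is the entry
   (i + 1, k + 1) in 1-based numbering, whence the ".+1" in the exponents and
   the unchanged index differences m + i - k and n + i - k. *)
Definition Sres_mx (K : fieldType) (d : nat) (f g : {poly K}) :
    'M[{poly K}]_((size f).-1 + (size g).-1 - 2 * d) :=
  let m := (size f).-1 in
  let n := (size g).-1 in
  \matrix_(i, k)
    if (i < n - d)%N then
      if (k < m + n - 2 * d - 1)%N then (coefz f (m%:Z + i%:Z - k%:Z))%:P
      else 'X^(n - d - i.+1) * f
    else
      let i' := (i - (n - d))%N in
      if (k < m + n - 2 * d - 1)%N then (coefz g (n%:Z + i'%:Z - k%:Z))%:P
      else 'X^(m - d - i'.+1) * g.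

(* Meaningful for f, g != 0 and d < min (deg f) (deg g). *)
Definition Sres (K : fieldType) (d : nat) (f g : {poly K}) : {poly K} :=
  \det (Sres_mx d f g).

(* The row index i : 'I_d stands for i + 1 in 1-based numbering. *)
Definition Hmx (m n d : nat) : 'M[int]_(d, d.+1) :=
  \matrix_(i, j) binz (m + n - 2 * d - 1) (m%:Z - i.+1%:Z - j%:Z).

(* For d = 0 this is the determinant of a 0 x 0 matrix, namely 1. *)
Definition q (m n d : nat) (j : 'I_d.+1) : int := \det (col' j (Hmx m n d)).

Lemma q_d0 (m n : nat) : q m n (ord0 : 'I_1) = 1.
Proof. exact: det_mx00. Qed.

(* Main.v *)
Require Import Defs.
From mathcomp Require Import all_boot all_order all_algebra.
From mathcomp Require Import zify ring.

(** Put v = x - beta, w = alpha - x, a = v + w = alpha - beta, r = n - d,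
    p = m - d, c = m + n - 2d - 1. The polynomials of degree at most c + d form
    a space V in which the c + d + 1 products b_i = v^i w^(c+d-i) are a basis as
    soon as a <> 0. The multiples of (x - alpha)^m by polynomials of degree < r
    are spanned by the b_i with i < r, and those of (x - beta)^n by polynomials
    of degree < p by the b_i with r + d <= i; the d indices r, ..., r + d - 1
    are missed. A change of basis in the two spaces of multipliers thus turns
    the rows of the subresultant matrix into the values of c + 1 linear maps on
    the b_i outside this gap: the c top coefficients, and the polynomial itself
    ([Sres_row_change]). The determinant of this change of basis is, up to sign,
    a power of a ([det_coef_binary_forms]).

    Add to these c + 1 maps the d coordinates along the b_i of the gap, and let
    G be the square matrix of the values of all these maps on all the b_i. Its
    determinant is computed twice.
    - The new columns are unit vectors supported on the gap, so det G is, up to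
      the sign of a permutation of the rows, the subresultant of the changed
      rows ([det_bordered_swap]).
    - For j <= d, the polynomial a^c v^j w^(d-j) = (v + w)^c v^j w^(d-j) has
      the coordinates binom(c, i - j) in the b_i. Replacing the last d + 1
      vectors b_i by these polynomials is a unitriangular operation. The new
      vectors have degree at most d, so that their c top coefficients vanish
      and the matrix becomes block triangular ([det_bordered_block]). The first
      block is again a power of a. The second one has first column
      a^c v^j w^(d-j) and, in its other columns, the binomial coefficients of [Hmx]
      in reversed order: its expansion along the first column is the sum
      of the theorem ([det_bordered_bin]).

    Comparing both values gives the theorem multiplied by a power of a
    ([Sres_powers_scaled]), which can be cancelled when a <> 0. When a = 0 both
    sides vanish, as the two spaces of multiples meet ([Sres_same_root]).

    Taking w = alpha - x rather than x - alpha makes v + w constant, and all the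
    binomial coefficients occur without signs. *)

Set Implicit Arguments.
Unset Strict Implicit.
Unset Printing Implicit Defensive.

Import GRing.Theory.
Local Open Scope ring_scope.

(** * Determinants of matrices indexed by natural numbers *)

(** Entries depend on the numbers i and j, not on ordinals, so that sizes can be
    split or rewritten without casts. *)
Definition natmx {R : nzRingType} (k : nat) (F : nat -> nat -> R) : 'M[R]_k :=
  \matrix_(i, j) F i j.

Section NatMx.
Variable R : comNzRingType.
Implicit Types (F A B : nat -> nat -> R) (f : nat -> nat).

Lemma eq_natmx k F A : (forall i j, (i < k)%N -> (j < k)%N -> F i j = A i j) ->
  natmx k F = natmx k A.
Proof. by move=> FA; apply/matrixP=> i j; rewrite !mxE FA. Qed.

Lemma mul_natmx k A B :
  natmx k A *m natmx k B = natmx k (fun i j => \sum_(l < k) A i l * B l j).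
Proof. by apply/matrixP=> i j; rewrite !mxE; apply: eq_bigr=> l _; rewrite !mxE. Qed.

Lemma det_natmx_trig k F :
  (forall i j, (i < j)%N -> (j < k)%N -> F i j = 0) ->
  \det (natmx k F) = \prod_(i < k) F i i.
Proof.
move=> F0; rewrite det_trig; first by apply: eq_bigr=> i _; rewrite mxE.
by apply/is_trig_mxP=> i j ij; rewrite mxE F0.
Qed.

Lemma det_natmx_tr k F : \det (natmx k F) = \det (natmx k (fun i j => F j i)).
Proof. by rewrite -det_tr; congr (\det _); apply/matrixP=> i j; rewrite !mxE. Qed.

Lemma det_natmx_ublock k l F :
  (forall i j, (i < l)%N -> (j < k)%N -> F (k + i)%N j = 0) ->
  \det (natmx (k + l) F) =
    \det (natmx k F) * \det (natmx l (fun i j => F (k + i)%N (k + j)%N)).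
Proof.
move=> F0; rewrite -[natmx (k + l) F]submxK.
have -> : dlsubmx (natmx (k + l) F) = 0.
  by apply/matrixP=> i j; rewrite !mxE /= F0.
rewrite det_ublock; congr (_ * _); congr (\det _);
  by apply/matrixP=> i j; rewrite !mxE.
Qed.

Lemma det_natmx_lblock k l F :
  (forall i j, (i < k)%N -> (j < l)%N -> F i (k + j)%N = 0) ->
  \det (natmx (k + l) F) =
    \det (natmx k F) * \det (natmx l (fun i j => F (k + i)%N (k + j)%N)).
Proof.
move=> F0; rewrite det_natmx_tr det_natmx_ublock; last by move=> i j *; exact: F0.
by rewrite -det_natmx_tr -[X in _ * X]det_natmx_tr.
Qed.

(** Multiplying by this matrix on the left replaces row i by row f i. *)
Definition selmx f (i j : nat) : R := (f i == j)%:R.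

Lemma det_natmx_rows k f F : (forall i, (i < k)%N -> (f i < k)%N) ->
  \det (natmx k (fun i j => F (f i) j)) = \det (natmx k (selmx f)) * \det (natmx k F).
Proof.
move=> fk; rewrite -det_mulmx mul_natmx; congr (\det _); apply: eq_natmx=> i j ik jk.
rewrite (bigD1 (Ordinal (fk i ik))) //= /selmx eqxx mul1r big1 ?addr0 // => l.
by rewrite eq_sym -val_eqE /= => /negPf->; rewrite mul0r.
Qed.

(** Expansion along the column 0, whose only nonzero entry is in row i0. The
    signs of the two permutations below follow by induction, without counting
    inversions. *)
Lemma det_selmx_rec k f i0 : (i0 <= k)%N -> f i0 = 0%N ->
    (forall i, i != i0 -> (i <= k)%N -> (0 < f i)%N) ->
  \det (natmx k.+1 (selmx f)) =
    (-1) ^+ i0 * \det (natmx k (selmx (fun i => (f (bump i0 i)).-1))).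
Proof.
rewrite -ltnS => i0k f0 fpos; set I := Ordinal i0k.
rewrite (expand_det_col _ ord0) (bigD1 I) //= big1 ?addr0 => [|i iI]; last first.
  rewrite mxE /selmx /= eqn0Ngt fpos ?mul0r //; last by rewrite -ltnS.
rewrite mxE /selmx /= f0 eqxx mul1r /cofactor /= addn0; congr (_ * \det _).
apply/matrixP=> i j; rewrite !mxE /= /selmx; congr (nat_of_bool _)%:R.
rewrite -[f _](@prednK (f (bump i0 i))) ?eqSS // fpos //; first by rewrite eq_sym neq_bump.
by have := ltn_ord (lift I i).
Qed.

Lemma det_selmx_rev k : \det (natmx k (selmx (fun i => k - i.+1)%N)) = (-1) ^+ 'C(k, 2).
Proof.
elim: k => [|k IHk]; first by rewrite det_mx00.
rewrite (@det_selmx_rec _ _ k) ?subnn // => [|i ik ile]; last by lia.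
rewrite (_ : natmx k _ = natmx k (selmx (fun i => k - i.+1)%N)); last first.
  by apply: eq_natmx=> i j ik _; rewrite /selmx; congr (nat_of_bool (_ == _))%:R;
    rewrite /bump; lia.
by rewrite IHk binS bin1 exprD mulrC.
Qed.

(** Rows 0 .. r - 1 are kept; of the next p + d rows, the last p come first and
    the first d come last. *)
Definition swap_blocks r p d i : nat :=
  if (i < r)%N then i else if (i < r + p)%N then (i + d)%N else (i - p)%N.

Lemma det_selmx_swap r p d :
  \det (natmx (r + (p + d)) (selmx (swap_blocks r p d))) = (-1) ^+ (p * d).
Proof.
(* the r fixed rows are removed one by one *)
elim: r => [|r IHr]; last first.
  rewrite addSn (@det_selmx_rec _ _ 0%N) // => [|i i0 _]; last first.
    by rewrite /swap_blocks; do ?case: ifP; lia.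
  rewrite expr0 mul1r -IHr; congr (\det _); apply: eq_natmx=> i j _ _.
  by rewrite /selmx; congr (nat_of_bool (_ == _))%:R;
    rewrite /swap_blocks /bump; do ?case: ifP; lia.
rewrite add0n; elim: d => [|d IHd].
  rewrite muln0 expr0 -(det1 R (p + 0)); congr (\det _); apply/matrixP=> i j.
  rewrite !mxE /selmx; congr (nat_of_bool _)%:R; rewrite -val_eqE /=; congr (_ == _).
  by move: (ltn_ord i); rewrite /swap_blocks; do ?case: ifP; lia.
rewrite addnS (@det_selmx_rec _ _ p) ?leq_addr //; first last.
- by move=> i; rewrite /swap_blocks; do ?case: ifP; lia.
- by rewrite /swap_blocks; do ?case: ifP; lia.
rewrite mulnS exprD -IHd; congr (_ * \det _); apply: eq_natmx=> i j _ _.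
by rewrite /selmx; congr (nat_of_bool (_ == _))%:R;
    rewrite /swap_blocks /bump; do ?case: ifP; lia.
Qed.

End NatMx.

(** * Coefficient matrices of binary forms *)

Section Powers.
Variable K : fieldType.

(** The degree s + (k - i.+1) of the powers decreases with i, and so does the
    index of the coefficients with j: the matrix is triangular. *)
Lemma det_coef_powers s k (z : {poly K}) : size z = 2%N ->
  \det (natmx k (fun i j => (z ^+ (s + (k - i.+1)))`_(s + (k - j.+1)))) =
    lead_coef z ^+ (s * k + 'C(k, 2)).
Proof.
move=> z2; rewrite det_natmx_tr det_natmx_trig => [|i j ij jk]; last first.
  by rewrite nth_default // (polySpred (expf_neq0 _ _)) -?size_poly_gt0 ?z2 // size_exp z2; lia.
rewrite (eq_bigr (fun i : 'I_k => lead_coef z ^+ (s + (k - i.+1)))) => [|i _]; last first.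
  by rewrite -lead_coef_exp lead_coefE size_exp z2 mul1n.
rewrite prodrXr big_split /= sum_nat_const card_ord mulnC; congr (_ ^+ (_ + _)).
by rewrite (reindex_inj rev_ord_inj) /= -bin2_sum big_mkord; apply: eq_bigr=> i _;
  have := ltn_ord i; lia.
Qed.

(** Expanding v^i = (a - w)^i writes row i as a combination of pure powers of
    w in which only rows l <= i occur, with coefficient a^i at l = i; this
    factors the matrix into a triangular one and the one of
    [det_coef_powers]. *)
Lemma det_coef_binary_forms s k (a : K) (v w : {poly K}) : size w = 2%N -> v + w = a%:P ->
  \det (natmx k (fun i j => (v ^+ i * w ^+ (s + (k - i.+1)))`_(s + (k - j.+1)))) =
    lead_coef w ^+ (s * k + 'C(k, 2)) * a ^+ 'C(k, 2).
Proof.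
move=> w2 vwa.
pose T i j := (w ^+ (s + (k - i.+1)))`_(s + (k - j.+1)).
pose A i l : K := (-1) ^+ (i - l) * a ^+ l *+ 'C(i, l).
have vw i : (i < k)%N -> v ^+ i * w ^+ (s + (k - i.+1)) =
    \sum_(l < k) A i l *: w ^+ (s + (k - l.+1)).
  move=> ik; have -> : v = - w + a%:P by rewrite -vwa; ring.
  rewrite exprDn mulr_suml.
  rewrite (big_ord_widen k (fun l => ((- w) ^+ (i - l) * a%:P ^+ l *+ 'C(i, l)) * _)) //.
  rewrite big_mkcond /=; apply: eq_bigr => l _; case: ltnP => [li|il]; last first.
    by rewrite /A bin_small // mulr0n scale0r.
  have -> : (s + (k - l.+1) = (i - l) + (s + (k - i.+1)))%N by lia.
  rewrite /A (exprNn w) -mul_polyC !(polyCMn, polyCM, polyC_exp, polyCN, polyC1) !exprD; ring.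
rewrite (@eq_natmx _ _ _ (fun i j => \sum_(l < k) A i l * T l j)); last first.
  by move=> i j ik _; rewrite vw // coef_sum; apply: eq_bigr=> l _; rewrite coefZ.
rewrite -mul_natmx det_mulmx det_coef_powers // mulrC; congr (_ * _).
rewrite det_natmx_trig => [|i j ij _]; last by rewrite /A bin_small.
rewrite (eq_bigr (fun i : 'I_k => a ^+ i)) => [|i _]; last first.
  by rewrite /A subnn binn mul1r.
by rewrite prodrXr -bin2_sum big_mkord.
Qed.
End Powers.

(** * Row operations on the subresultant matrix *)

Section Functionals.
Variable K : fieldType.
Implicit Types P f g : {poly K}.

(** Column k of the subresultant matrix, as a linear map on polynomials of
    degree at most e: the coefficients in decreasing order of degree for
    k < c, then the polynomial itself. *)
Definition sres_col e c (k : nat) P : {poly K} := if (k < c)%N then (P`_(e - k))%:P else P.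

Lemma sres_col_sum e c k l (a : nat -> K) (F : nat -> {poly K}) :
  sres_col e c k (\sum_(i < l) a i *: F i) = \sum_(i < l) (a i)%:P * sres_col e c k (F i).
Proof.
rewrite /sres_col; case: ifP => _; last by apply: eq_bigr=> i _; rewrite mul_polyC.
by rewrite coef_sum rmorph_sum; apply: eq_bigr=> i _; rewrite coefZ rmorphM.
Qed.

Lemma poly_rev_sum l P : (size P <= l)%N ->
  P = \sum_(i < l) P`_(l - i.+1) *: 'X^(l - i.+1).
Proof.
move=> Pl; rewrite [LHS](_ : P = \sum_(i < l) P`_i *: 'X^i); last first.
  by rewrite -poly_def; apply/polyP=> i; rewrite coef_poly; case: ltnP=> // li;
    rewrite nth_default // (leq_trans Pl).
by rewrite (reindex_inj rev_ord_inj).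
Qed.

Lemma sres_col_mul e c k l P f : (size P <= l)%N ->
  sres_col e c k (P * f) = \sum_(i < l) (P`_(l - i.+1))%:P * sres_col e c k ('X^(l - i.+1) * f).
Proof.
move=> Pl; rewrite {1}(poly_rev_sum Pl) mulr_suml.
under eq_bigr do rewrite -scalerAl.
exact: (@sres_col_sum _ _ _ _ (fun i => P`_(l - i.+1)) (fun i => 'X^(l - i.+1) * f)).
Qed.

Lemma Sres_natmx m n d f g :
    size f = m.+1 -> size g = n.+1 -> (d < minn m n)%N ->
  Sres d f g = \det (natmx ((n - d) + (m - d)) (fun i k =>
    sres_col (m + n - d).-1 (m + n - 2 * d).-1 k
      (if (i < n - d)%N then 'X^(n - d - i.+1) * f else 'X^(m - d - (i - (n - d)).+1) * g))).
Proof.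
move=> fm gn dmn.
have coefz_shift P t N i k : (k <= N)%N -> (i < t)%N ->
    coefz P (N%:Z - t%:Z + i.+1%:Z - k%:Z) = ('X^(t - i.+1) * P)`_(N - k).
  move=> kN it; rewrite coefXnM; case: ltnP => h.
    have : (N%:Z - t%:Z + i.+1%:Z - k%:Z < 0 :> int)%R by lia.
    by case: (N%:Z - t%:Z + i.+1%:Z - k%:Z).
  by have -> : N%:Z - t%:Z + i.+1%:Z - k%:Z = (N - k - (t - i.+1))%:Z by lia.
rewrite /Sres; transitivity (\det (natmx (m + n - 2 * d) (fun i k =>
  sres_col (m + n - d).-1 (m + n - 2 * d).-1 k
    (if (i < n - d)%N then 'X^(n - d - i.+1) * f
     else 'X^(m - d - (i - (n - d)).+1) * g)))); last first.
  by congr (\det (natmx _ _)); lia.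
rewrite /Sres_mx fm gn /=; congr (\det _); apply/matrixP=> i k.
rewrite !mxE /sres_col subn1; have := ltn_ord i; have := ltn_ord k.
case: (ltnP i (n - d)) => ir; case: (ltnP k (_.-1)) => kc // kN iN; congr _%:P;
  by rewrite -coefz_shift; [congr coefz|..]; lia.
Qed.

(** The multipliers x^(n-d-1-i) of f and x^(m-d-1-i) of g may be replaced by any
    polynomials of degrees less than n - d and m - d: each column is a linear
    map, so this multiplies the matrix on the left by the block diagonal matrix
    of the coefficients of the new multipliers. *)
Lemma Sres_row_change m n d f g (A B : nat -> {poly K}) :
    size f = m.+1 -> size g = n.+1 -> (d < minn m n)%N ->
    (forall i, (i < n - d)%N -> (size (A i) <= n - d)%N) ->
    (forall i, (i < m - d)%N -> (size (B i) <= m - d)%N) ->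
  (\det (natmx (n - d) (fun i j => (A i)`_(n - d - j.+1))) *
   \det (natmx (m - d) (fun i j => (B i)`_(m - d - j.+1))))%:P * Sres d f g =
  \det (natmx ((n - d) + (m - d)) (fun i k =>
    sres_col (m + n - d).-1 (m + n - 2 * d).-1 k
      (if (i < n - d)%N then A i * f else B (i - (n - d))%N * g))).
Proof.
move=> fm gn dmn sA sB; rewrite (Sres_natmx fm gn) //.
set r := (n - d)%N in sA *; set p := (m - d)%N in sB *.
set e := (_.-1); set c := (_.-1).
pose M i j : {poly K} := if (i < r)%N then (if (j < r)%N then ((A i)`_(r - j.+1))%:P else 0)
  else if (j < r)%N then 0 else ((B (i - r)%N)`_(p - (j - r).+1))%:P.
have -> : (\det (natmx r (fun i j => (A i)`_(r - j.+1))) *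
   \det (natmx p (fun i j => (B i)`_(p - j.+1))))%:P = \det (natmx (r + p) M).
  rewrite det_natmx_ublock => [|i j ip jr]; last by rewrite /M ltnNge leq_addr jr.
  rewrite polyCM -!det_map_mx; congr (_ * _); congr (\det _); apply/matrixP=> i j;
    rewrite !mxE /M.
    by rewrite !ltn_ord.
  by rewrite !ltnNge !leq_addr /= !addKn.
rewrite -det_mulmx mul_natmx; congr (\det _); apply: eq_natmx => i k ik kk.
rewrite big_split_ord /= /M; case: ltnP => ir.
  rewrite [X in _ + X]big1 ?addr0 => [|l _]; last by rewrite ltnNge leq_addr mul0r.
  by rewrite (@sres_col_mul _ _ _ r) ?sA //; apply: eq_bigr=> l _; rewrite !ltn_ord.
rewrite [X in X + _]big1 ?add0r => [|l _]; last by rewrite ltn_ord mul0r.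
rewrite (@sres_col_mul _ _ _ p) ?sB //; last by lia.
by apply: eq_bigr=> l _; rewrite ltnNge leq_addr /= addKn.
Qed.

(** With the powers of x - alpha as multipliers, the first row of each of the
    two blocks is (x - alpha)^(m+n-d-1). *)
Lemma Sres_same_root m n d (alpha : K) : (d < minn m n)%N ->
  Sres d (('X - alpha%:P) ^+ m) (('X - alpha%:P) ^+ n) = 0.
Proof.
move=> dmn; set u := _ - _; have u2 : size u = 2%N by rewrite size_XsubC.
have det1u l : \det (natmx l (fun i j => (u ^+ (l - i.+1))`_(l - j.+1))) = 1.
  by have := det_coef_powers 0 l u2; rewrite lead_coefXsubC expr1n.
have su l : size (u ^+ l) = l.+1 by rewrite size_exp_XsubC.
have := @Sres_row_change m n d _ _ (fun i => u ^+ (n - d - i.+1))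
  (fun i => u ^+ (m - d - i.+1)) (su _) (su _) dmn.
rewrite !det1u !mul1r => -> => [|i ir|i ip]; [|by rewrite su; lia|by rewrite su; lia].
have r0 : (0 < n - d + (m - d))%N by lia.
have rr : (n - d < n - d + (m - d))%N by lia.
apply: (@determinant_alternate _ _ _ (Ordinal r0) (Ordinal rr)).
  by rewrite -val_eqE /=; lia.
move=> k; rewrite !mxE /= ltnn subnn; case: ltnP; last lia.
by move=> _; rewrite -!exprD; congr (sres_col _ _ _ (_ ^+ _)); lia.
Qed.

End Functionals.

(** * The minors of the binomial matrix *)

(** The truncated subtraction makes the test necessary. *)
Definition shifted_bin c j e : nat := if (j <= e)%N then 'C(c, e - j) else 0.

(** Homogeneous coordinates of (v + w)^c v^j w^(d-j) in the products
    v^e w^(c+d-e). *)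
Lemma bin_formD (R : comNzRingType) (v w : R) c d j : (j <= d)%N ->
  \sum_(e < c.+1 + d) (shifted_bin c j e)%:R * (v ^+ e * w ^+ (c + d - e)) =
  (v + w) ^+ c * (v ^+ j * w ^+ (d - j)).
Proof.
move=> jd; pose F e := (shifted_bin c j e)%:R * (v ^+ e * w ^+ (c + d - e)).
transitivity (\sum_(0 <= e < c.+1 + d) F e); first by rewrite big_mkord.
have jc : (j <= j + c.+1)%N by exact: leq_addr.
have jcd : (j + c.+1 <= c.+1 + d)%N by lia.
(* the coefficient vanishes for e < j and for j + c < e *)
rewrite (big_cat_nat (leq0n j) (leq_trans jc jcd)) (big_cat_nat jc jcd) /=.
rewrite big_nat big1 ?add0r => [|e /andP[_ ej]]; last first.
  by rewrite /F /shifted_bin leqNgt ej mul0r.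
rewrite [X in _ + X]big_nat [X in _ + X]big1 ?addr0 => [|e /andP[je _]]; last first.
  rewrite /F /shifted_bin (leq_trans jc je) bin_small ?mul0r //; lia.
rewrite (_ : \sum_(j <= e < j + c.+1) F e = \sum_(i < c.+1) F (i + j)%N); last first.
  by rewrite -{1}[j]add0n big_addn addKn big_mkord.
rewrite addrC exprDn mulr_suml; apply: eq_bigr => i _; have := ltn_ord i => ic.
rewrite /F /shifted_bin leq_addl addnK exprD.
rewrite (_ : c + d - (i + j) = (c - i) + (d - j))%N; last by lia.
by rewrite exprD -mulr_natr; ring.
Qed.

Section Minors.
Variables m n d : nat.
Hypothesis dmn : (d < minn m n)%N.
Let c := (m + n - 2 * d).-1.
Let r := (n - d)%N.

(** The exponent j of v corresponds to the column d - j of [Hmx], and the two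
    binomial coefficients have complementary lower indices. *)
Lemma Hmx_shifted_bin (i j : nat) : (j <= d)%N -> (i < d)%N ->
  binz (m + n - 2 * d - 1) (m%:Z - i.+1%:Z - (d - j)%N%:Z) = shifted_bin c j (r + i)%N.
Proof.
move=> jd id; rewrite /shifted_bin subn1 -/c /r; case: leqP => ji.
  case: (leqP (n - d + i - j) c) => ic.
    have -> : m%:Z - i.+1%:Z - (d - j)%N%:Z = (c - (n - d + i - j))%N%:Z.
      by rewrite /c; lia.
    by rewrite /= bin_sub.
  rewrite bin_small //.
  have : (m%:Z - i.+1%:Z - (d - j)%N%:Z < 0 :> int)%R by move: ic; rewrite /c; lia.
  by case: (_ - _).
have -> : m%:Z - i.+1%:Z - (d - j)%N%:Z = (m - i.+1 - (d - j))%N%:Z by lia.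
by rewrite /= bin_small //; move: ji; rewrite /c; lia.
Qed.

(** Rows are in the order opposite to that of the columns of [Hmx], whence the
    sign of the reversal of d elements, which is the sign of the theorem. *)
Lemma minor_shifted_bin (R : comNzRingType) (i : 'I_d.+1) :
  \det (row' i (\matrix_(j < d.+1, k < d) (shifted_bin c j (r + k))%:R)) =
  (-1) ^+ 'C(d, 2) * (q m n (rev_ord i))%:~R :> R.
Proof.
rewrite -det_selmx_rev /q -(det_map_mx intr) -[\det (map_mx _ _)]det_tr.
rewrite -det_mulmx; congr (\det _); apply/matrixP=> j k; rewrite !mxE.
rewrite (bigD1 (rev_ord j)) //= big1 ?addr0 => [|l lj]; last first.
  rewrite !mxE /selmx (_ : (_ == _) = false) ?mul0r //.
  by apply: contraNF lj => /eqP E; rewrite -val_eqE /= -E.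
rewrite !mxE /selmx /= eqxx mul1r.
have -> : bump (d - i)%N (d - j.+1) = (d - bump i j)%N.
  by rewrite /bump; have := ltn_ord j; have := ltn_ord i; case: (leqP i j); lia.
by rewrite Hmx_shifted_bin // /bump; have := ltn_ord j; lia.
Qed.

(** Expansion along the first column. After reversal, the cofactor of index i
    has the sign (-1)^(d-i). *)
Lemma det_bordered_bin (R : comNzRingType) (x : nat -> R) :
  \det (natmx d.+1 (fun i t => if t is t'.+1 then (shifted_bin c i (r + t'))%:R else x i)) =
  (-1) ^+ 'C(d, 2) * \sum_(i < d.+1) (-1) ^+ (d - i) * x (d - i)%N * (q m n i)%:~R.
Proof.
rewrite (expand_det_col _ ord0) mulr_sumr (reindex_inj rev_ord_inj) /=.
apply: eq_bigr => i _; rewrite mxE /cofactor /= addn0 subSS.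
rewrite (_ : \det _ =
    \det (row' (rev_ord i)
      (\matrix_(j < d.+1, k < d) (shifted_bin c j (r + k))%:R : 'M[R]_(d.+1, d)))); last first.
  by congr (\det _); apply/matrixP=> j k; rewrite !mxE /=.
by rewrite minor_shifted_bin rev_ordK; ring.
Qed.

End Minors.

(** * Subresultants of powers of linear polynomials *)

Lemma bin2D x y : 'C(x + y, 2) = ('C(x, 2) + 'C(y, 2) + x * y)%N.
Proof.
elim: x => [|x IH]; first by rewrite add0n bin0n addn0.
by rewrite addSn !binS !bin1 IH; lia.
Qed.

Section LinearPowers.
Variables (K : fieldType) (m n d : nat) (alpha beta : K).
Hypothesis dmn : (d < minn m n)%N.
Let c := (m + n - 2 * d).-1.
Let r := (n - d)%N.
Let p := (m - d)%N.
Let a := alpha - beta.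
Let v : {poly K} := 'X - beta%:P.
Let w : {poly K} := alpha%:P - 'X.

Let b i : {poly K} := v ^+ i * w ^+ (c + d - i).
Let phi k (P : {poly K}) := sres_col (c + d) c k P.

Lemma addvw : v + w = a%:P.
Proof. by rewrite /v /w /a polyCB; ring. Qed.

Lemma size_w : size w = 2%N.
Proof. by rewrite /w -opprB size_polyN size_XsubC. Qed.

Lemma lead_coef_w : lead_coef w = -1.
Proof. by rewrite /w -opprB lead_coefN lead_coefXsubC. Qed.

Lemma size_vw i j : size (v ^+ i * w ^+ j) = (i + j).+1.
Proof.
have w0 : w != 0 by rewrite -size_poly_gt0 size_w.
have v0 : v != 0 by rewrite -size_poly_gt0 size_XsubC.
rewrite size_mul ?expf_neq0 // size_exp_XsubC (polySpred (expf_neq0 _ w0)).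
by rewrite size_exp size_w; lia.
Qed.

(** The matrix G of the introduction: columns k <= c hold the subresultant
    maps, and the last d columns the coordinates along the b_i of the gap. *)
Definition bordered i k : {poly K} :=
  if (k < c.+1)%N then phi k (b i) else (i == r + (k - c.+1))%N%:R.

(** Moving the d rows of the gap below the p rows that follow them makes the
    matrix block lower triangular, with an identity block. *)
Lemma det_bordered_swap :
  \det (natmx (c.+1 + d) bordered) = (-1) ^+ (p * d) *
   \det (natmx (r + p) (fun i k => phi k (b (if (i < r)%N then i else (i + d)%N)))).
Proof.
have cE : c.+1 = (r + p)%N by rewrite /c /r /p; lia.
have -> : \det (natmx (r + p) (fun i k => phi k (b (if (i < r)%N then i else (i + d)%N)))) =
    \det (natmx (c.+1 + d) (fun i k => bordered (swap_blocks r p d i) k)).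
  rewrite cE [RHS]det_natmx_lblock; last first.
    move=> i j ic jd; rewrite /bordered -cE ltnNge leq_addr addKn /= /swap_blocks.
    by rewrite (_ : (_ == _) = false) //; do ?case: ifP; lia.
  rewrite -[LHS]mulr1; congr (_ * _).
    congr (\det _); apply: eq_natmx=> i k ic kc.
    by rewrite /bordered cE kc /swap_blocks ic; case: ifP.
  rewrite -(det1 _ d); congr (\det _); apply/matrixP=> i j; rewrite !mxE.
  rewrite /bordered -cE ltnNge leq_addr /= addKn /swap_blocks.
  congr (nat_of_bool _)%:R; rewrite -val_eqE /=.
  by have := ltn_ord i; have := ltn_ord j; do ?case: ifP; lia.
rewrite det_natmx_rows; last by move=> i; rewrite cE /swap_blocks; do ?case: ifP; lia.
have -> : \det (natmx (c.+1 + d) (selmx {poly K} (swap_blocks r p d))) = (-1) ^+ (p * d).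
  rewrite -(det_selmx_swap _ r p d); congr (\det (natmx _ _)); lia.
(* the sign is its own inverse *)
by rewrite mulrA -exprD addnn -signr_odd odd_double mul1r.
Qed.

(** The last d + 1 basis vectors are replaced by (v + w)^c v^j w^(d-j), in
    which b_(c+j) has coefficient 1 and no later b_i occurs. *)
Lemma det_bordered_block : \det (natmx (c.+1 + d) bordered) =
  (lead_coef w ^+ (d.+1 * c + 'C(c, 2)) * a ^+ 'C(c, 2))%:P *
  ((-1) ^+ 'C(d, 2) *
   \sum_(i < d.+1) (-1) ^+ (d - i) * ((a ^+ c)%:P * (v ^+ (d - i) * w ^+ i)) * (q m n i)%:~R).
Proof.
pose L i e : {poly K} := if (i < c)%N then (i == e)%:R else (shifted_bin c (i - c) e)%:R.
have detL : \det (natmx (c.+1 + d) L) = 1.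
  rewrite det_natmx_trig => [|i j ij jN]; last first.
    rewrite /L; case: ltnP => ic; first by rewrite (ltn_eqF ij).
    by rewrite /shifted_bin bin_small ?if_same //; lia.
  rewrite big1 // => i _; rewrite /L; case: ltnP; rewrite ?eqxx // => ci.
  by rewrite /shifted_bin leq_subr subKn // binn.
rewrite -[LHS]mul1r -[X in X * _ = _]detL -det_mulmx mul_natmx.
set F := (fun i j : nat => _); rewrite addSnnS.
have Ftop i k : (i < c)%N -> F i k = bordered i k.
  move=> ic; have iN : (i < c.+1 + d)%N by lia.
  rewrite /F (bigD1 (Ordinal iN)) //= big1 ?addr0 => [|l]; first by rewrite /L ic eqxx mul1r.
  by rewrite eq_sym -val_eqE /L ic /= => /negPf->; rewrite mul0r.
have Fphi j k : (j <= d)%N -> (k <= c)%N ->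
    F (c + j)%N k = phi k ((a ^+ c) *: (v ^+ j * w ^+ (d - j))).
  move=> jd kc; rewrite -mul_polyC polyC_exp -addvw -bin_formD //.
  rewrite (_ : \sum_(e < _) _ = \sum_(e < c.+1 + d) (shifted_bin c j e)%:R *: b e); last first.
    by apply: eq_bigr=> e _; rewrite -mul_polyC polyC_natr.
  rewrite /phi (@sres_col_sum _ _ _ _ _ (fun e => (shifted_bin c j e)%:R) b).
  apply: eq_bigr=> e _.
  by rewrite /L ltnNge leq_addr addKn /= /bordered ltnS kc polyC_natr.
have Fsel j t : (t < d)%N -> F (c + j)%N (c + t.+1)%N = (shifted_bin c j (r + t))%:R.
  move=> td; have rtN : (r + t < c.+1 + d)%N by rewrite /r /c; lia.
  rewrite /F (bigD1 (Ordinal rtN)) //= big1 ?addr0 => [|l].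
    rewrite /L /bordered ltnNge leq_addr addKn /= ifN -?leqNgt; last by lia.
    by rewrite (_ : c + t.+1 - c.+1 = t)%N ?eqxx ?mulr1 //; lia.
  rewrite -val_eqE /bordered /= ifN -?leqNgt; last by lia.
  by rewrite (_ : c + t.+1 - c.+1 = t)%N => [/negPf->|]; rewrite ?mulr0 //; lia.
rewrite det_natmx_ublock; last first.
  move=> i k id kc; rewrite Fphi ?(ltnW kc) // /phi /sres_col kc coefZ nth_default ?mulr0 //.
  by rewrite size_vw; lia.
congr (_ * _).
  (* for i < c, b_i is divisible by w^(d+1) *)
  rewrite -(det_coef_binary_forms d.+1 c size_w addvw) -det_map_mx; congr (\det _).
  apply/matrixP=> i k; rewrite !mxE Ftop //.
  rewrite /bordered ltnS (ltnW (ltn_ord k)) /phi /sres_col ltn_ord /b.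
  have -> : (c + d - i = d.+1 + (c - i.+1))%N by have := ltn_ord i; lia.
  by have -> : (c + d - k = d.+1 + (c - k.+1))%N by have := ltn_ord k; lia.
pose x i := (a ^+ c)%:P * (v ^+ i * w ^+ (d - i)).
rewrite (_ : \sum_(i < d.+1) _ =
    \sum_(i < d.+1) (-1) ^+ (d - i) * x (d - i)%N * (q m n i)%:~R); last first.
  by apply: eq_bigr=> i _; rewrite /x subKn // -ltnS.
rewrite -(det_bordered_bin dmn); congr (\det _); apply: eq_natmx => i [|t] id td.
  by rewrite addn0 Fphi // /phi /sres_col ltnn /x mul_polyC.
by rewrite Fsel.
Qed.

(** The factor on both sides is, up to sign, the determinant of the change of
    multipliers: the v^i w^(r-1-i) for (x - alpha)^m, and the v^i w^(p-1-i) for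
    (x - beta)^n. *)
Lemma Sres_powers_scaled :
  (a ^+ ('C(r, 2) + 'C(p, 2)))%:P *
  Sres d (('X - alpha%:P) ^+ m) (('X - beta%:P) ^+ n) =
  (a ^+ ('C(r, 2) + 'C(p, 2)))%:P *
  (((-1) ^+ 'C(d, 2) * a ^+ (p * r)) *:
    \sum_(j < d.+1)
      (q m n j)%:~R *: (('X - alpha%:P) ^+ j * ('X - beta%:P) ^+ (d - j))).
Proof.
set u := 'X - alpha%:P.
have uE k : u ^+ k = (-1) ^+ k * w ^+ k by rewrite -exprNn opprB.
pose sgn e : K := (-1) ^+ e.
have sizeb l i : (i < l)%N -> size (v ^+ i * w ^+ (0 + (l - i.+1))) = l.
  by move=> il; rewrite size_vw; lia.
(* sgn m compensates for (x - alpha)^m = (-1)^m w^m *)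
have := @Sres_row_change K m n d (u ^+ m) (v ^+ n)
  (fun i => sgn m *: (v ^+ i * w ^+ (0 + (r - i.+1))))
  (fun i => v ^+ i * w ^+ (0 + (p - i.+1)))
  (size_exp_XsubC _ _) (size_exp_XsubC _ _) dmn.
rewrite -/r -/p -[(m + n - 2 * d).-1]/c (_ : (m + n - d).-1 = (c + d)%N);
  last by rewrite /c; lia.
rewrite (_ : \det (natmx (r + p) _) =
  \det (natmx (r + p) (fun i k => phi k (b (if (i < r)%N then i else (i + d)%N))))); last first.
  congr (\det _); apply: eq_natmx=> i k ic _; rewrite /phi; congr sres_col; rewrite /b.
  case: ltnP => ir; first last.
    rewrite mulrAC -exprD; congr (_ ^+ _ * _ ^+ _); rewrite /c /r /p; lia.
  have -> : (c + d - i = 0 + (r - i.+1) + m)%N by rewrite /c /r; lia.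
  have s2 : (-1) ^+ m * (-1) ^+ m = 1 :> {poly K} by rewrite -exprMn mulrNN mulr1 expr1n.
  by rewrite uE -mul_polyC rmorphXn rmorphN1 !exprD -[RHS]mul1r -[X in _ = X * _]s2; ring.
rewrite (_ : natmx r _ = sgn m *: natmx r (fun i j =>
    (v ^+ i * w ^+ (0 + (r - i.+1)))`_(0 + (r - j.+1)))); last first.
  by apply/matrixP=> i j; rewrite !mxE coefZ.
rewrite detZ (det_coef_binary_forms 0 r size_w addvw).
rewrite (det_coef_binary_forms 0 p size_w addvw) lead_coef_w => scaled.
have := det_bordered_swap; rewrite -scaled => [|i ir|i ip]; last first.
- by rewrite sizeb.
- by rewrite (leq_trans (size_scale_leq _ _)) // sizeb.
rewrite det_bordered_block lead_coef_w.
set S := Sres _ _ _; set Q := \sum_(j < _) _ *: _.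
rewrite (_ : \sum_(i < d.+1) _ = (sgn d * a ^+ c) *: Q); last first.
  rewrite scaler_sumr; apply: eq_bigr=> i _; rewrite uE.
  have s2 : (-1) ^+ (d - i) = (-1) ^+ d * (-1) ^+ i :> {poly K}.
    have id : (i <= d)%N by rewrite -ltnS.
    by rewrite -[X in _ = _ ^+ X * _](subnK id) exprD -mulrA -exprMn mulrNN mulr1 expr1n mulr1.
  by rewrite -!mul_polyC !rmorphM !rmorphXn rmorphN1 rmorph_int s2 /v; ring.
(* both sides are now scalar multiples of S and Q; only signs and the exponents
   of a remain to be compared *)
have sP e : (-1) ^+ e = (sgn e)%:P by rewrite rmorphXn rmorphN1.
have sgnM e e' : sgn (e + e')%N = sgn e * sgn e' by exact: exprD.
rewrite !sP !mul_polyC !scalerA !mul0n !add0n => QS.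
pose T := (p * d + m * r + 'C(r, 2) + 'C(p, 2))%N.
have sgnT : sgn T * sgn T = 1 by rewrite -exprMn mulrNN mulr1 expr1n.
have -> : a ^+ ('C(r, 2) + 'C(p, 2)) = sgn T * (sgn (p * d) *
    (sgn m ^+ r * ((-1) ^+ 'C(r, 2) * a ^+ 'C(r, 2)) * ((-1) ^+ 'C(p, 2) * a ^+ 'C(p, 2)))).
  rewrite exprD -[LHS]mul1r -[X in X * _ = _]sgnT {2}/T !sgnM /sgn -exprM; ring.
rewrite -[LHS]scalerA -QS scalerA; congr (_ *: _).
have binE : ('C(c, 2) + c = 'C(r, 2) + 'C(p, 2) + r * p)%N.
  by rewrite -bin2D (_ : r + p = c.+1)%N ?binS ?bin1 //; rewrite /c /r /p; lia.
have parity : (T + (d.+1 * c + 'C(c, 2)) + d =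
    (p * d + d * r + p * r + 'C(r, 2) + 'C(p, 2)) +
    (p * d + d * r + p * r + 'C(r, 2) + 'C(p, 2)))%N.
  have mr : (m * r = p * r + d * r)%N by rewrite -mulnDl /p subnK //; lia.
  have dc : (d * c + d = d * p + d * r)%N.
    by rewrite addnC -mulnS -mulnDr; congr (_ * _)%N; rewrite /c /r /p; lia.
  by rewrite /T mr mulSn; lia.
transitivity (sgn (T + (d.+1 * c + 'C(c, 2)) + d)%N * sgn 'C(d, 2) * a ^+ ('C(c, 2) + c)).
  by rewrite !sgnM !exprD /sgn; ring.
rewrite parity sgnM -[sgn _ * sgn _]exprMn mulrNN mulr1 expr1n mul1r binE !exprD.
rewrite -[LHS]mul1r -[X in X * _ = _]sgnT {2}/T !sgnM /sgn -exprM (mulnC r p); ring.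
Qed.
End LinearPowers.

Theorem theorem1p1 (K : fieldType) (m n d : nat) (alpha beta : K)
    (hd : (d < minn m n)%N) :
  Sres d (('X - alpha%:P) ^+ m) (('X - beta%:P) ^+ n) =
  ((-1) ^+ 'C(d, 2) * (alpha - beta) ^+ ((m - d) * (n - d))) *:
    \sum_(j < d.+1)
      (q m n j)%:~R *: (('X - alpha%:P) ^+ j * ('X - beta%:P) ^+ (d - j)).
Proof.
have [->|ab] := eqVneq alpha beta.
  rewrite Sres_same_root // subrr expr0n muln_eq0 !subn_eq0.
  by rewrite (_ : (_ || _) = false) ?mulr0 ?scale0r //; lia.
apply: mulfI (Sres_powers_scaled alpha beta hd).
by rewrite polyC_eq0 expf_eq0 subr_eq0 (negPf ab) andbF.
Qed.
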